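(* The weighted least squares estimator of the batch-mode regression form $\widetilde{z}_k=\widetilde{H}_kx_k+\widetilde{e}_k$, where $$\widetilde{z}_k=\begin{bmatrix} z_k+H_k\widehat{x}_{k|k-1}-h(\widehat{x}_{k|k-1})\\ \widehat{x}_{k|k-1}\end{bmatrix},\qquad \widetilde{H}_k=\begin{bmatrix}H_k\\ I\end{bmatrix},\qquad \widetilde{e}_k=\begin{bmatrix}\nu_k+\varepsilon_k\\ -\delta_k\end{bmatrix},$$ $$W_k=\mathbb{E}[\widetilde{e}_k\widetilde{e}_k^T]=\begin{bmatrix}\Sigma_{k|k-1}&0\\0&P^{xx}_{k|k-1}\end{bmatrix},\qquad \Sigma_{k|k-1}=R_k+\widetilde{R}_k,$$ yields an estimated state vector $$\widehat{x}_{k|k}=\left(\widetilde{H}_k^TW_k^{-1}\widetilde{H}_k\right)^{-1}\widetilde{H}_k^TW_k^{-1}\widetilde{z}_k$$ and its associated covariance matrix $$P^{xx}_{k|k}=\left(\widetilde{H}_k^TW_k^{-1}\widetilde{H}_k\right)^{-1}$$ that are equivalent to those of the unscented Kalman filter (UKF), namely $$\widehat{x}_{k|k}=\widehat{x}_{k|k-1}+K_k\left(z_k-\widehat{z}_{k|k-1}\right),\qquad P^{xx}_{k|k}=P^{xx}_{k|k-1}-K_kP^{zz}_{k|k-1}K_k^T,\qquad K_k=P^{xz}_{k|k-1}\left(P^{zz}_{k|k-1}\right)^{-1}.$$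
   Context: System: $x_k=f(x_{k-1},u_k)+w_k$, $z_k=h(x_k,u_k)+v_k$, with state $x_k\in\mathbb{R}^n$, observation $z_k\in\mathbb{R}^m$, input $u_k$, vector-valued nonlinear functions $f,h$, and process and observation noises $w_k,v_k$ that are independent and identically distributed with zero mean and covariance matrices $Q_k$ and $R_k$. The input argument of $f$ and $h$ is suppressed below. UKF quantities: given the state estimate $\widehat{x}_{k-1|k-1}$ with covariance matrix $P^{xx}_{k-1|k-1}$, the $2n$ sigma points $\chi^i_{k-1|k-1}$ are $\widehat{x}_{k-1|k-1}\pm\left(\sqrt{nP^{xx}_{k-1|k-1}}\right)_i$ (columns of a matrix square root), with weights $w_i=\frac1{2n}$, $i=1,\dots,2n$. Put $\chi^i_{k|k-1}=f(\chi^i_{k-1|k-1})$, $z^i_{k|k-1}=h(\chi^i_{k|k-1})$, and $$\widehat{x}_{k|k-1}=\sum_{i=1}^{2n}w_i\chi^i_{k|k-1},\qquad \widehat{z}_{k|k-1}=\sum_{i=1}^{2n}w_iz^i_{k|k-1},$$ $$P^{xx}_{k|k-1}=\sum_{i=1}^{2n}w_i(\chi^i_{k|k-1}-\widehat{x}_{k|k-1})(\chi^i_{k|k-1}-\widehat{x}_{k|k-1})^T+Q_k,$$ $$P^{zz}_{k|k-1}=\sum_{i=1}^{2n}w_i(z^i_{k|k-1}-\widehat{z}_{k|k-1})(z^i_{k|k-1}-\widehat{z}_{k|k-1})^T+R_k,$$ $$P^{xz}_{k|k-1}=\sum_{i=1}^{2n}w_i(\chi^i_{k|k-1}-\widehat{x}_{k|k-1})(z^i_{k|k-1}-\widehat{z}_{k|k-1})^T.$$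 Batch-mode regression quantities: $\delta_k=x_k-\widehat{x}_{k|k-1}$ is the prediction error, where $x_k$ is the true state, with $\mathbb{E}[\delta_k\delta_k^T]=P^{xx}_{k|k-1}$. Statistical linearization of the observation equation gives $z_k=H_k(x_k-\widehat{x}_{k|k-1})+h(\widehat{x}_{k|k-1})+\nu_k+\varepsilon_k$, where $H_k=(P^{xz}_{k|k-1})^T(P^{xx}_{k|k-1})^{-1}$, $\varepsilon_k$ is the observation noise (covariance $R_k$), and $\nu_k$ is the statistical linearization error, with covariance $$\widetilde{R}_k=\mathbb{E}[\nu_k\nu_k^T]=P^{zz}_{k|k-1}-(P^{xz}_{k|k-1})^T(P^{xx}_{k|k-1})^{-1}P^{xz}_{k|k-1},$$ in which $P^{zz}_{k|k-1}$ and $P^{xz}_{k|k-1}$ are the UKF covariance matrices above. $I$ is the $n\times n$ identity matrix. The batch-mode form stacks this equation with $\widehat{x}_{k|k-1}=x_k-\delta_k$.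
   Formalization: R̃_k is taken with P^zz minus R_k, since otherwise R_k is counted twice; h(x̂) in z̃_k and in the regression equation is replaced by an arbitrary vector c, with state K_k(z_k−c) correction, and equality with the UKF state is claimed for c=ẑ_{k|k-1}. *)

(* Defs.v *)
From HB Require Import structures.
From mathcomp Require Import all_boot all_order all_algebra.
From mathcomp Require Import all_classical all_reals all_analysis.
Set Implicit Arguments.
Unset Strict Implicit.
Unset Printing Implicit Defensive.
Import Order.TTheory GRing.Theory Num.Theory.
Local Open Scope ring_scope.

(* One step of the filter is considered, so the time indices are dropped:
   f and h are the system functions at time k with the known input u_k
   substituted, x0 and P0 are the estimate and the covariance at time k-1,
   and Q, Rn are the process and observation noise covariances. *)

Definition covariance_mx (R : realType) (n : nat) (M : 'M[R]_n) : Prop :=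
  M^T = M /\ forall v : 'cV[R]_n, 0 <= (v^T *m M *m v) 0 0.

(* S is any matrix square root of n P0, not necessarily the symmetric one
   (a Cholesky factor is allowed). *)
Definition matrix_sqrt (R : realType) (n : nat) (S M : 'M[R]_n) : Prop :=
  S *m S^T = M.

(* The 2n sigma points: x0 + (column j of S), then x0 - (column j of S). *)
Definition sigma_point (R : realType) (n : nat) (x0 : 'cV[R]_n) (S : 'M[R]_n)
    (i : 'I_(n + n)) : 'cV[R]_n :=
  match fintype.split i with
  | inl j => x0 + col j S
  | inr j => x0 - col j S
  end.

Definition ut_weight (R : realType) (n : nat) : R := (2 * n)%:R^-1.

Definition ut_mean (R : realType) (n p : nat)
    (y : 'I_(n + n) -> 'cV[R]_p) : 'cV[R]_p :=
  \sum_i ut_weight R n *: y i.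

(* Weighted (cross-)covariance of two families of 2n transformed points,
   with no noise covariance added. *)
Definition ut_cov (R : realType) (n p q : nat)
    (y : 'I_(n + n) -> 'cV[R]_p) (z : 'I_(n + n) -> 'cV[R]_q) : 'M[R]_(p, q) :=
  \sum_i ut_weight R n *: ((y i - ut_mean y) *m (z i - ut_mean z)^T).

Section Ukf.
Context (R : realType) (n m : nat).
Context (f : 'cV[R]_n -> 'cV[R]_n) (h : 'cV[R]_n -> 'cV[R]_m).
Context (x0 : 'cV[R]_n) (S : 'M[R]_n).

Definition ukf_chi (i : 'I_(n + n)) : 'cV[R]_n := f (sigma_point x0 S i).
Definition ukf_zeta (i : 'I_(n + n)) : 'cV[R]_m := h (ukf_chi i).
Definition ukf_xpred : 'cV[R]_n := ut_mean ukf_chi.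
Definition ukf_zpred : 'cV[R]_m := ut_mean ukf_zeta.
Definition ukf_Pxx (Q : 'M[R]_n) : 'M[R]_n := ut_cov ukf_chi ukf_chi + Q.
Definition ukf_Phh : 'M[R]_m := ut_cov ukf_zeta ukf_zeta.
Definition ukf_Pzz (Rn : 'M[R]_m) : 'M[R]_m := ukf_Phh + Rn.
Definition ukf_Pxz : 'M[R]_(n, m) := ut_cov ukf_chi ukf_zeta.
Definition ukf_gain (Rn : 'M[R]_m) : 'M[R]_(n, m) :=
  ukf_Pxz *m invmx (ukf_Pzz Rn).
Definition ukf_estimate (Rn : 'M[R]_m) (z : 'cV[R]_m) : 'cV[R]_n :=
  ukf_xpred + ukf_gain Rn *m (z - ukf_zpred).
Definition ukf_cov (Q : 'M[R]_n) (Rn : 'M[R]_m) : 'M[R]_n :=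
  ukf_Pxx Q - ukf_gain Rn *m ukf_Pzz Rn *m (ukf_gain Rn)^T.

Definition slr_H (Q : 'M[R]_n) : 'M[R]_(m, n) :=
  ukf_Pxz^T *m invmx (ukf_Pxx Q).

(* Covariance of the error made in replacing h by its statistical
   linearization.  The covariance that enters here is the one of h(x) itself,
   ukf_Phh, which is ukf_Pzz without the summand Rn: the observation noise is
   accounted for separately in batch_Sigma.  With ukf_Pzz Rn in place of
   ukf_Phh, Rn would be counted twice and the gains would not agree. *)
Definition slr_Rtilde (Q : 'M[R]_n) : 'M[R]_m :=
  ukf_Phh - ukf_Pxz^T *m invmx (ukf_Pxx Q) *m ukf_Pxz.

Definition batch_Sigma (Q : 'M[R]_n) (Rn : 'M[R]_m) : 'M[R]_m :=
  Rn + slr_Rtilde Q.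
Definition batch_W (Q : 'M[R]_n) (Rn : 'M[R]_m) : 'M[R]_(m + n) :=
  block_mx (batch_Sigma Q Rn) 0 0 (ukf_Pxx Q).
Definition batch_H (Q : 'M[R]_n) : 'M[R]_(m + n, n) :=
  col_mx (slr_H Q) 1%:M.

(* c is the constant term of the linearization
   z = H (x - xpred) + c + nu + eps; the usual choices are c = h(xpred) and
   c = zpred, which differ in general for nonlinear h. *)
Definition batch_z (Q : 'M[R]_n) (c z : 'cV[R]_m) : 'cV[R]_(m + n) :=
  col_mx (z + slr_H Q *m ukf_xpred - c) ukf_xpred.

End Ukf.

Section Wls.
Context (R : realType) (p n : nat).

Definition wls_cost (A : 'M[R]_(p, n)) (W : 'M[R]_p) (y : 'cV[R]_p)
    (x : 'cV[R]_n) : R :=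
  ((y - A *m x)^T *m invmx W *m (y - A *m x)) 0 0.

Definition is_wls_estimate (A : 'M[R]_(p, n)) (W : 'M[R]_p) (y : 'cV[R]_p)
    (x : 'cV[R]_n) : Prop :=
  forall x' : 'cV[R]_n, x' != x -> wls_cost A W y x < wls_cost A W y x'.

Definition wls_cov (A : 'M[R]_(p, n)) (W : 'M[R]_p) : 'M[R]_n :=
  invmx (A^T *m invmx W *m A).

Definition wls_estimate (A : 'M[R]_(p, n)) (W : 'M[R]_p) (y : 'cV[R]_p) :
    'cV[R]_n :=
  wls_cov A W *m A^T *m invmx W *m y.

End Wls.

Section RandomVectors.
Context d (T : measurableType d) (R : realType) (P : probability T R).

Definition random_vector (p : nat) (X : T -> 'cV[R]_p) : Prop :=
  forall i, measurable_fun [set: T] (fun w => X w i 0).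

Definition zero_mean (p : nat) (X : T -> 'cV[R]_p) : Prop :=
  forall i, P.-integrable [set: T] (fun w => (X w i 0%R)%:E) /\
            ('E_P[fun w => X w i 0%R] = 0)%E.

(* E[X X^T] = M.  The diagonal entries being finite, a random vector with
   this property has square-integrable components. *)
Definition has_second_moment (p : nat) (X : T -> 'cV[R]_p) (M : 'M[R]_p) :
    Prop :=
  forall i j, ('E_P[fun w => (X w i 0 * X w j 0)%R] = (M i j)%:E)%E.

End RandomVectors.

(* Main.v *)
(* Write P for Pxx, C for Pxz and Sigma for Rn + Rtilde, so that H = C^T P^-1.
   Since W is block diagonal, the information matrix of the regression is
   H^T Sigma^-1 H + P^-1, and Pzz = Sigma + H P H^T because Rtilde is Phh with
   H P H^T removed.  The Woodbury identity then turns the inverse of the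
   information matrix into P - C Pzz^-1 C^T, and the weighted least squares
   gain into C Pzz^-1.  Invertibility and strict minimality need W positive
   definite: Rtilde is a Schur complement of the joint covariance of the
   transformed sigma points, hence positive semidefinite. *)

Require Import Defs.
From HB Require Import structures.
From mathcomp Require Import all_boot all_order all_algebra.
From mathcomp Require Import all_classical all_reals all_analysis.
From mathcomp Require Import measurable_realfun ring lra.
Set Implicit Arguments.
Unset Strict Implicit.
Unset Printing Implicit Defensive.
Import Order.TTheory GRing.Theory Num.Theory.
Local Open Scope ring_scope.

(** * Semidefinite and definite quadratic forms, and Schur complements *)

Section QuadraticForms.
Context (R : realType).

Definition posdef_mx (n : nat) (M : 'M[R]_n) : Prop :=
  M^T = M /\ forall v : 'cV[R]_n, v != 0 -> 0 < (v^T *m M *m v) 0 0.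

Lemma norm2E (n : nat) (v : 'cV[R]_n) : (v^T *m v) 0 0 = \sum_i v i 0 ^+ 2.
Proof. by rewrite mxE; apply: eq_bigr => i _; rewrite mxE -expr2. Qed.

Lemma norm2_ge0 (n : nat) (v : 'cV[R]_n) : 0 <= (v^T *m v) 0 0.
Proof. by rewrite norm2E sumr_ge0 // => i _; exact: sqr_ge0. Qed.

Lemma norm2_eq0 (n : nat) (v : 'cV[R]_n) : (v^T *m v) 0 0 = 0 -> v = 0.
Proof.
rewrite norm2E => /eqP.
rewrite psumr_eq0 => [/allP v0|i _]; last exact: sqr_ge0.
apply/matrixP => i j; rewrite ord1 mxE; apply/eqP.
by have := v0 i (mem_index_enum i); rewrite sqrf_eq0.
Qed.

Lemma qformD (n : nat) (M : 'M[R]_n) (u v : 'cV[R]_n) : M^T = M ->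
  ((u + v)^T *m M *m (u + v)) 0 0 =
  (u^T *m M *m u) 0 0 + 2 * (v^T *m M *m u) 0 0 + (v^T *m M *m v) 0 0.
Proof.
move=> Ms.
have uv : (u^T *m M *m v) 0 0 = (v^T *m M *m u) 0 0.
  by rewrite -[in LHS](trmxK (u^T *m M *m v)) mxE !trmx_mul trmxK Ms mulmxA.
rewrite [(u + v)^T]linearD /= !mulmxDl !mulmxDr !mxE.
move: uv; rewrite !mxE => ->; ring.
Qed.

Lemma covariance_mxD (n : nat) (A B : 'M[R]_n) :
  covariance_mx A -> covariance_mx B -> covariance_mx (A + B).
Proof.
move=> [As A0] [Bs B0]; split; first by rewrite linearD /= As Bs.
by move=> v; rewrite mulmxDr mulmxDl mxE addr_ge0.
Qed.

Lemma covariance_mx_congr (n m : nat) (A : 'M[R]_(m, n)) (M : 'M[R]_n) :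
  covariance_mx M -> covariance_mx (A *m M *m A^T).
Proof.
move=> [Ms M0]; split; first by rewrite !trmx_mul trmxK Ms mulmxA.
by move=> v; have := M0 (A^T *m v); rewrite trmx_mul trmxK !mulmxA.
Qed.

(** Lets [Q] be added to the state block alone of a joint state-observation covariance. *)
Lemma covariance_mx_ext0 (n m : nat) (A : 'M[R]_n) :
  covariance_mx A -> covariance_mx (block_mx A 0 0 (0 : 'M[R]_m)).
Proof.
move=> [As A0]; split; first by rewrite tr_block_mx !trmx0 As.
move=> v; rewrite -(vsubmxK v) tr_col_mx mul_row_block !mulmx0 !addr0.
by rewrite mul_row_col mul0mx addr0.
Qed.

Lemma posdefD (n : nat) (A B : 'M[R]_n) :
  posdef_mx A -> covariance_mx B -> posdef_mx (A + B).
Proof.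
move=> [As A0] [Bs B0]; split; first by rewrite linearD /= As Bs.
by move=> v v0; rewrite mulmxDr mulmxDl mxE ltr_wpDr ?A0.
Qed.

(** A row [u] of the left kernel satisfies [u *m M = 0], so the form vanishes at [u^T], which forces
    [u = 0]. *)
Lemma posdef_unitmx (n : nat) (M : 'M[R]_n) : posdef_mx M -> M \in unitmx.
Proof.
move=> [Ms M0]; rewrite -row_free_unit -kermx_eq0; apply/eqP/row_matrixP => i.
rewrite row0; apply: trmx_inj; rewrite trmx0; apply/eqP/negP => /negP/M0.
by rewrite trmxK -row_mul mulmx_ker row0 mul0mx mxE ltxx.
Qed.

Lemma posdef_block_diag (n m : nat) (A : 'M[R]_n) (B : 'M[R]_m) :
  posdef_mx A -> posdef_mx B -> posdef_mx (block_mx A 0 0 B).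
Proof.
move=> [As A0] [Bs B0]; split; first by rewrite tr_block_mx !trmx0 As Bs.
have ge0 k (M : 'M[R]_k) : posdef_mx M ->
    forall v : 'cV[R]_k, 0 <= (v^T *m M *m v) 0 0.
  move=> [_ M0] v; have [->|/M0/ltW//] := eqVneq v 0.
  by rewrite mulmx0 mxE.
move=> v; rewrite -(vsubmxK v) tr_col_mx mul_row_block !mulmx0 addr0 add0r.
rewrite mul_row_col mxE; set a := usubmx v; set b := dsubmx v.
have [->|a0] := eqVneq a 0; last by rewrite ltr_pwDl ?A0 ?ge0.
have [->|b0] := eqVneq b 0; last by rewrite ltr_wpDl ?B0 ?ge0.
by rewrite col_mx0 eqxx.
Qed.

Lemma covariance_mx_posdef (n : nat) (M : 'M[R]_n) :
  covariance_mx M -> M \in unitmx -> posdef_mx M.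
Proof.
move=> [Ms M0] Mu; split => // v v0; rewrite lt_neqAle M0 andbT eq_sym.
apply: contra_neq v0 => vMv.
(* The form is nonnegative at v - t M v for every t, where its linear term in
   t is - 2 t |M v|^2. *)
set y := M *m v; set b := (y^T *m M *m y) 0 0; set a := (y^T *m y) 0 0.
have b0 : 0 <= b by exact: M0.
have pos t : 0 <= t ^+ 2 * b - 2 * t * a.
  have := M0 (v + (- t) *: y); rewrite qformD // vMv add0r.
  rewrite [(_ *: y)^T]linearZ /= -!scalemxAl -!scalemxAr -(mulmxA y^T) -/y.
  have scE k (A : 'M[R]_1) : (k *: A) 0 0 = k * A 0 0 by rewrite mxE.
  rewrite !scE -/a -/b.
  by congr (0 <= _); ring.
have a0 : a = 0.
  have b1 : b + 1 != 0 by rewrite gt_eqF // ltr_wpDl.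
  have := pos (a / (b + 1)).
  have -> : (a / (b + 1)) ^+ 2 * b - 2 * (a / (b + 1)) * a =
      - ((a / (b + 1)) ^+ 2 * (b + 2)) by field.
  rewrite oppr_ge0 pmulr_lle0 ?ltr_wpDl // => a2.
  have : (a / (b + 1)) ^+ 2 == 0 by rewrite eq_le a2 sqr_ge0.
  by rewrite sqrf_eq0 mulf_eq0 invr_eq0 (negbTE b1) orbF => /eqP.
by rewrite -(mulKmx Mu v) -/y (norm2_eq0 a0) mulmx0.
Qed.

Lemma posdef_inv (n : nat) (M : 'M[R]_n) : posdef_mx M -> posdef_mx (invmx M).
Proof.
move=> Mp; have Mu := posdef_unitmx Mp; case: Mp => Ms M0.
split=> [|v v0]; first by rewrite trmx_inv Ms.
have -> : v^T *m invmx M *m v = (invmx M *m v)^T *m M *m (invmx M *m v).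
  by rewrite trmx_mul trmx_inv Ms -(mulmxA _ M) mulKVmx.
by apply: M0; apply: contra_neq v0 => v0; rewrite -(mulKVmx Mu v) v0 mulmx0.
Qed.

Lemma posdef_congr (p n : nat) (A : 'M[R]_(p, n)) (M : 'M[R]_p) :
  (forall v : 'cV[R]_n, A *m v = 0 -> v = 0) -> posdef_mx M ->
  posdef_mx (A^T *m M *m A).
Proof.
move=> A_inj [Ms M0]; split; first by rewrite !trmx_mul trmxK Ms mulmxA.
move=> v v0; rewrite !mulmxA -trmx_mul -mulmxA; apply: M0.
by apply: contra_neq v0 => /A_inj.
Qed.

Lemma covariance_mx_schur (n m : nat) (A : 'M[R]_n) (B : 'M[R]_(n, m))
    (D : 'M[R]_m) :
  covariance_mx (block_mx A B B^T D) -> A \in unitmx ->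
  covariance_mx (D - B^T *m invmx A *m B).
Proof.
move=> [M_sym M0] Au; move: M_sym; rewrite tr_block_mx trmxK.
move=> /eq_block_mx[As _ _ Ds].
split; first by rewrite linearB /= Ds !trmx_mul trmx_inv As trmxK mulmxA.
(* This choice of the first block minimizes the form of the block matrix over
   all vectors with second block v. *)
move=> v; have := M0 (col_mx (- (invmx A *m B *m v)) v).
rewrite tr_col_mx mul_row_block mul_row_col [(- _)^T]linearN /=.
rewrite !trmx_mul trmx_inv As.
rewrite !mulNmx !mulmxN -!mulmxA mulVmx // mulmx1 addNr mul0mx oppr0 add0r.
by rewrite addrC -mulmxBr -mulmxA.
Qed.

End QuadraticForms.

(** * Sigma-point covariances and the linearization error covariance *)

Section UnscentedTransform.
Context (R : realType) (n : nat).

Lemma ut_mean_col_mx (p q : nat) (y : 'I_(n + n) -> 'cV[R]_p)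
    (z : 'I_(n + n) -> 'cV[R]_q) :
  ut_mean (fun i => col_mx (y i) (z i)) = col_mx (ut_mean y) (ut_mean z).
Proof.
rewrite /ut_mean.
elim/big_rec3: _ => [|i u v w _ ->]; first by rewrite col_mx0.
by rewrite scale_col_mx add_col_mx.
Qed.

Lemma trmx_ut_cov (p q : nat) (y : 'I_(n + n) -> 'cV[R]_p)
    (z : 'I_(n + n) -> 'cV[R]_q) : (ut_cov y z)^T = ut_cov z y.
Proof.
rewrite /ut_cov [(\sum_i _)^T]linear_sum; apply: eq_bigr => i _.
by rewrite linearZ /= trmx_mul trmxK.
Qed.

(** Stacking the two families pointwise makes the block matrix a single weighted covariance, so its
    semidefiniteness comes from [covariance_ut_cov]. *)
Lemma ut_cov_block (p q : nat) (y : 'I_(n + n) -> 'cV[R]_p)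
    (z : 'I_(n + n) -> 'cV[R]_q) :
  ut_cov (fun i => col_mx (y i) (z i)) (fun i => col_mx (y i) (z i)) =
  block_mx (ut_cov y y) (ut_cov y z) (ut_cov y z)^T (ut_cov z z).
Proof.
rewrite trmx_ut_cov /ut_cov ut_mean_col_mx.
under eq_bigr do
  rewrite opp_col_mx add_col_mx tr_col_mx mul_col_row scale_block_mx.
apply/matrixP => i j; rewrite summxE.
case: (split_ordP i) => k ->; case: (split_ordP j) => l ->.
all: rewrite ?block_mxEul ?block_mxEur ?block_mxEdl ?block_mxEdr summxE.
all: apply: eq_bigr => a _.
all: by rewrite ?block_mxEul ?block_mxEur ?block_mxEdl ?block_mxEdr.
Qed.

(** Each summand is a nonnegative weight times a rank-one matrix [e *m e^T], whose form at [v] is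
    the square of [e^T *m v]. *)
Lemma covariance_ut_cov (p : nat) (y : 'I_(n + n) -> 'cV[R]_p) :
  covariance_mx (ut_cov y y).
Proof.
split=> [|v]; first exact: trmx_ut_cov.
rewrite /ut_cov mulmx_sumr mulmx_suml summxE; apply: sumr_ge0 => i _.
rewrite -scalemxAr -scalemxAl mxE mulr_ge0 ?invr_ge0 ?ler0n //.
set e := y i - _.
have -> : v^T *m (e *m e^T) *m v = (e^T *m v)^T *m (e^T *m v).
  by rewrite trmx_mul trmxK !mulmxA.
exact: norm2_ge0.
Qed.

Lemma slr_Rtilde_covariance (m : nat) (f : 'cV[R]_n -> 'cV[R]_n)
    (h : 'cV[R]_n -> 'cV[R]_m) (x0 : 'cV[R]_n) (S Q : 'M[R]_n) :
  covariance_mx Q -> ukf_Pxx f x0 S Q \in unitmx ->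
  covariance_mx (slr_Rtilde f h x0 S Q).
Proof.
move=> Q_cov; apply: covariance_mx_schur.
(* Of the four blocks only [ukf_Pxx] carries a noise term, so the matrix is the stacked sigma-point
   covariance plus [Q] in its upper left corner. *)
have -> : block_mx (ukf_Pxx f x0 S Q) (ukf_Pxz f h x0 S)
    (ukf_Pxz f h x0 S)^T (ukf_Phh f h x0 S) =
    ut_cov (fun i => col_mx (ukf_chi f x0 S i) (ukf_zeta f h x0 S i))
      (fun i => col_mx (ukf_chi f x0 S i) (ukf_zeta f h x0 S i)) +
    block_mx Q 0 0 0.
  by rewrite ut_cov_block add_block_mx !addr0.
by apply: covariance_mxD (covariance_ut_cov _) (covariance_mx_ext0 _ Q_cov).
Qed.

End UnscentedTransform.

(** * Optimality and error covariance of weighted least squares *)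

Section WeightedLeastSquares.
Context (R : realType) (p n : nat) (A : 'M[R]_(p, n)) (W : 'M[R]_p).
Hypothesis A_inj : forall v : 'cV[R]_n, A *m v = 0 -> v = 0.
Hypothesis W_posdef : posdef_mx W.

Let W_inv : posdef_mx (invmx W) := posdef_inv W_posdef.
Let AWA_posdef : posdef_mx (A^T *m invmx W *m A) := posdef_congr A_inj W_inv.
Let AWA_unit : A^T *m invmx W *m A \in unitmx := posdef_unitmx AWA_posdef.

Lemma wls_cov_sym : (wls_cov A W)^T = wls_cov A W.
Proof. by rewrite /wls_cov trmx_inv AWA_posdef.1. Qed.

Lemma wls_normal_eq (y : 'cV[R]_p) :
  A^T *m invmx W *m (y - A *m wls_estimate A W y) = 0.
Proof.
by rewrite mulmxBr /wls_estimate /wls_cov !mulmxA mulmxV // mul1mx subrr.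
Qed.

(** Pythagoras in the metric [invmx W]: by the normal equation the residual is orthogonal to the
    range of [A], so moving to [x'] adds exactly the form at [A *m (x - x')], positive because [A]
    is injective. *)
Lemma wls_estimate_min (y : 'cV[R]_p) :
  is_wls_estimate A W y (wls_estimate A W y).
Proof.
move=> x' x'_neq; have := wls_normal_eq y.
set x := wls_estimate A W y => normal_eq; rewrite /wls_cost.
have -> : y - A *m x' = (y - A *m x) + A *m (x - x').
  by rewrite mulmxBr addrA subrK.
rewrite [X in _ < X]qformD ?W_inv.1 //.
rewrite trmx_mul -[in X in 2 * X]mulmxA -[in X in 2 * X]mulmxA.
rewrite (mulmxA A^T) normal_eq mulmx0 -trmx_mul.
rewrite [fun_of_matrix 0 0 0]mxE mulr0 addr0 ltrDl; apply: W_inv.2.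
by apply: contra_neq x'_neq => /A_inj/eqP; rewrite subr_eq0 => /eqP.
Qed.

(** The gain [wls_cov A W *m A^T *m invmx W] is a left inverse of [A]; hence the estimation error
    depends on the noise alone. *)
Lemma wls_estimate_linear (x : 'cV[R]_n) (e : 'cV[R]_p) :
  wls_estimate A W (A *m x + e) = x + wls_estimate A W e.
Proof.
rewrite /wls_estimate mulmxDr; congr (_ + _).
by rewrite /wls_cov -(mulmxA _ A^T) mulmxA -(mulmxA _ _ A) mulVmx ?mul1mx.
Qed.

Lemma wls_gain_cov :
  let G := wls_cov A W *m A^T *m invmx W in
  G *m W *m G^T = wls_cov A W.
Proof.
rewrite /= !trmx_mul trmxK wls_cov_sym W_inv.1.
rewrite mulmxKV ?posdef_unitmx // -mulmxA.
suff -> : A^T *m (invmx W *m (A *m wls_cov A W)) = 1%:M by rewrite mulmx1.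
by rewrite /wls_cov !mulmxA mulmxV.
Qed.

End WeightedLeastSquares.

(** * Second moments of random vectors under linear maps *)

Section SecondMoments.
Context d (T : measurableType d) (R : realType) (P : probability T R).

Lemma random_vectorD (p : nat) (X Y : T -> 'cV[R]_p) :
  random_vector X -> random_vector Y -> random_vector (fun w => X w + Y w).
Proof.
move=> mX mY i.
under eq_fun do rewrite mxE.
exact: measurable_funD.
Qed.

Lemma random_vectorN (p : nat) (X : T -> 'cV[R]_p) :
  random_vector X -> random_vector (fun w => - X w).
Proof.
move=> mX i.
under eq_fun do rewrite mxE.
exact: measurable_funN.
Qed.

Lemma random_vector_col_mx (p q : nat) (X : T -> 'cV[R]_p)
    (Y : T -> 'cV[R]_q) :
  random_vector X -> random_vector Y ->
  random_vector (fun w => col_mx (X w) (Y w)).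
Proof.
move=> mX mY i; case: (split_ordP i) => k ->.
- by under eq_fun do rewrite col_mxEu; exact: mX.
- by under eq_fun do rewrite col_mxEd; exact: mY.
Qed.

Lemma second_moment_integrable (p : nat) (X : T -> 'cV[R]_p) (M : 'M[R]_p)
    (i j : 'I_p) :
  random_vector X -> has_second_moment P X M ->
  P.-integrable [set: T] (EFin \o (fun w => X w i 0 * X w j 0)).
Proof.
move=> mX XM.
(* A square is its own absolute value, so its expectation being the real number [M k k] already
   gives integrability. Mixed products are then dominated by the sum of two squares. *)
have sqr_int k : P.-integrable [set: T] (EFin \o (fun w => X w k 0 * X w k 0)).
  apply/integrableP; split.
    by apply/measurable_EFinP; exact: measurable_funM.
  under eq_integral => w _ do
    rewrite /= ger0_norm -?expr2 ?sqr_ge0 // expr2.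
  by have := XM k k; rewrite unlock => ->; rewrite ltry.
apply: (le_integrable measurableT _ _
  (integrableD measurableT (sqr_int i) (sqr_int j))).
  by apply/measurable_EFinP; exact: measurable_funM.
move=> w _; rewrite /= lee_fin -!expr2 [leRHS]ger0_norm ?addr_ge0 ?sqr_ge0 //.
rewrite ler_norml; apply/andP; split; nra.
Qed.

(** Each entry expands into a finite double sum of products of components; their integrability
    allows the expectation to pass inside. *)
Lemma second_moment_mul (p q : nat) (A : 'M[R]_(q, p)) (X : T -> 'cV[R]_p)
    (M : 'M[R]_p) :
  random_vector X -> has_second_moment P X M ->
  has_second_moment P (fun w => A *m X w) (A *m M *m A^T).
Proof.
move=> mX XM i j; rewrite unlock.
have XX k l := second_moment_integrable k l mX XM.
have E w : ((A *m X w) i 0 * (A *m X w) j 0)%:E =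
    \sum_k \sum_l ((A i k * A j l)%:E * (X w k 0 * X w l 0)%:E)%E.
  rewrite !mxE big_distrlr /= -sumEFin; apply: eq_bigr => k _.
  rewrite -sumEFin; apply: eq_bigr => l _.
  by rewrite -EFinM; congr (_%:E); ring.
under eq_integral => w _ do rewrite E.
have ZXX k l := integrableZl measurableT (A i k * A j l) (XX k l).
rewrite integral_sum // => [|k]; last exact: integrable_sum.
have -> : (A *m M *m A^T) i j = \sum_k \sum_l A i k * A j l * M k l.
  rewrite mxE exchange_big /=; apply: eq_bigr => l _.
  by rewrite !mxE big_distrl /=; apply: eq_bigr => k _; ring.
rewrite -sumEFin; apply: eq_bigr => k _.
rewrite integral_sum // -sumEFin; apply: eq_bigr => l _.
rewrite integralZl //; last exact: XX.
rewrite [RHS]EFinM; congr (_ * _)%E.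
by have := XM k l; rewrite unlock.
Qed.

End SecondMoments.

(** * The Woodbury identity for the information matrix *)

Section InformationForm.
Context (R : realType) (n m : nat).
Context (Pxx : 'M[R]_n) (H : 'M[R]_(m, n)) (Sigma Pzz : 'M[R]_m).
Hypothesis Pxx_unit : Pxx \in unitmx.
Hypotheses (Sigma_unit : Sigma \in unitmx) (Pzz_unit : Pzz \in unitmx).
Hypothesis PzzE : Pzz = Sigma + H *m Pxx *m H^T.

(** Push-through identity: the information matrix times [Pxx *m H^T] is [H^T *m invmx Sigma *m (H *m
    Pxx *m H^T + Sigma)], and the last factor is [Pzz]. *)
Lemma information_gain :
  (H^T *m invmx Sigma *m H + invmx Pxx) *m (Pxx *m H^T *m invmx Pzz) =
  H^T *m invmx Sigma.
Proof.
rewrite mulmxDl !mulmxA mulVmx // mul1mx -(mulmxA _ H Pxx) -(mulmxA _ _ H^T).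
have -> : H *m Pxx *m H^T = Pzz - Sigma by rewrite PzzE addrC addKr.
by rewrite mulmxBr mulmxBl mulmxK // mulmxKV // subrK.
Qed.

(** By [information_gain] the subtracted term contributes [H^T *m invmx Sigma *m H *m Pxx],
    cancelling all but the identity. For square matrices this one-sided inverse is the inverse. *)
Lemma information_mulmx :
  (H^T *m invmx Sigma *m H + invmx Pxx) *m
    (Pxx - Pxx *m H^T *m invmx Pzz *m (H *m Pxx)) = 1%:M.
Proof.
rewrite mulmxBr (mulmxA _ _ (H *m Pxx)) information_gain mulmxDl mulVmx //.
by rewrite -(mulmxA _ H Pxx) addrC addKr.
Qed.

Lemma information_invmx :
  invmx (H^T *m invmx Sigma *m H + invmx Pxx) =
  Pxx - Pxx *m H^T *m invmx Pzz *m (H *m Pxx).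
Proof.
have [info_unit _] := mulmx1_unit information_mulmx.
by rewrite -[RHS](mulKmx info_unit) information_mulmx mulmx1.
Qed.

End InformationForm.

(** * Agreement of the regression estimate with the UKF update *)

Theorem theorem2 (R : realType) (n m : nat)
    (f : 'cV[R]_n -> 'cV[R]_n) (h : 'cV[R]_n -> 'cV[R]_m)
    (x0 : 'cV[R]_n) (P0 S Q : 'M[R]_n) (Rn : 'M[R]_m)
    (P0_cov : covariance_mx P0) (Q_cov : covariance_mx Q)
    (Rn_cov : covariance_mx Rn)
    (S_sqrt : matrix_sqrt S (n%:R *: P0))
    (Pxx_unit : ukf_Pxx f x0 S Q \in unitmx)
    (Sigma_unit : batch_Sigma f h x0 S Q Rn \in unitmx)
    (d : measure_display) (T : measurableType d) (P : probability T R)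
    (x : T -> 'cV[R]_n) (z nu eps : T -> 'cV[R]_m) (c : 'cV[R]_m) :
  let xpred := ukf_xpred f x0 S in
  let zpred := ukf_zpred f h x0 S in
  let Pxx := ukf_Pxx f x0 S Q in
  let H := slr_H f h x0 S Q in
  let delta := fun w => x w - xpred in
  let Htilde := batch_H f h x0 S Q in
  let W := batch_W f h x0 S Q Rn in
  let ztilde := fun w => batch_z f h x0 S Q c (z w) in
  let etilde := fun w => col_mx (nu w + eps w) (- delta w) in
  let xhat := fun w => wls_estimate Htilde W (ztilde w) in
  random_vector x -> random_vector nu -> random_vector eps ->
  (forall w, z w = H *m (x w - xpred) + c + nu w + eps w) ->
  zero_mean P eps ->
  has_second_moment P delta Pxx ->
  has_second_moment P eps Rn ->
  has_second_moment P nu (slr_Rtilde f h x0 S Q) ->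
  has_second_moment P etilde W ->
  (forall w, ztilde w = Htilde *m x w + etilde w) /\
  [/\ forall w, is_wls_estimate Htilde W (ztilde w) (xhat w),
      has_second_moment P (fun w => xhat w - x w) (wls_cov Htilde W),
      wls_cov Htilde W = ukf_cov f h x0 S Q Rn,
      forall w, xhat w = xpred + ukf_gain f h x0 S Rn *m (z w - c)
    & c = zpred -> forall w, xhat w = ukf_estimate f h x0 S Rn (z w)].
Proof.
move=> xpred zpred Pxx H delta Htilde W ztilde etilde xhat.
move=> mx mnu meps zE _ _ _ _ eW.
have Rt_cov : covariance_mx (slr_Rtilde f h x0 S Q).
  exact: slr_Rtilde_covariance.
have Sigma_posdef : posdef_mx (batch_Sigma f h x0 S Q Rn).
  by apply: covariance_mx_posdef => //; exact: covariance_mxD.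
have Pxx_cov : covariance_mx Pxx.
  exact: covariance_mxD (covariance_ut_cov _) Q_cov.
have Pxx_posdef := covariance_mx_posdef Pxx_cov Pxx_unit.
have W_posdef : posdef_mx W by exact: posdef_block_diag.
have W_inv : invmx W = block_mx (invmx (batch_Sigma f h x0 S Q Rn)) 0 0
    (invmx Pxx) by apply/invmx_block_diag/posdef_unitmx.
(* The identity in the lower block leaves no kernel. *)
have Htilde_inj (v : 'cV[R]_n) : Htilde *m v = 0 -> v = 0.
  by rewrite mul_col_mx mul1mx -[0]col_mx0 => /eq_col_mx[].
have modelE w : ztilde w = Htilde *m x w + etilde w.
  rewrite /ztilde /batch_z /Htilde mul_col_mx add_col_mx mul1mx zE.
  rewrite /delta subKr mulmxBr -/xpred -/H; congr (col_mx _ _).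
  move: (H *m x w) (H *m xpred) => a b.
  by apply/matrixP => i j; rewrite !mxE; ring.
have Pxx_H : Pxx *m H^T = ukf_Pxz f h x0 S.
  by rewrite trmx_mul trmxK trmx_inv Pxx_posdef.1 mulKVmx.
have H_Pxx : H *m Pxx = (ukf_Pxz f h x0 S)^T by rewrite mulmxKV.
have PzzE : ukf_Pzz f h x0 S Rn =
    batch_Sigma f h x0 S Q Rn + H *m Pxx *m H^T.
  rewrite -mulmxA Pxx_H /batch_Sigma /slr_Rtilde -addrA subrK.
  by rewrite [RHS]addrC.
(* A definite matrix plus a semidefinite one; this makes the UKF gain a genuine quotient by
   [Pzz]. *)
have Pzz_posdef : posdef_mx (ukf_Pzz f h x0 S Rn).
  by rewrite PzzE; exact: posdefD (covariance_mx_congr H Pxx_cov).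
have Pzz_unit := posdef_unitmx Pzz_posdef.
have HW : Htilde^T *m invmx W =
    row_mx (H^T *m invmx (batch_Sigma f h x0 S Q Rn)) (invmx Pxx).
  rewrite W_inv tr_col_mx mul_row_block !mulmx0 addr0 add0r.
  by rewrite trmx1 mul1mx.
have infoE : Htilde^T *m invmx W *m Htilde =
    H^T *m invmx (batch_Sigma f h x0 S Q Rn) *m H + invmx Pxx.
  by rewrite HW mul_row_col mulmx1.
have covE : wls_cov Htilde W = ukf_cov f h x0 S Q Rn.
  rewrite /wls_cov infoE (information_invmx Pxx_unit _ Pzz_unit PzzE) //.
  rewrite Pxx_H H_Pxx /ukf_cov /ukf_gain mulmxKV //.
  by rewrite trmx_mul trmx_inv Pzz_posdef.1 mulmxA.
(* The block of the regression gain that acts on the observation: [information_gain] rewrites it as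
   the inverse information matrix times the information matrix times the UKF gain. *)
have gainE : wls_cov Htilde W *m (H^T *m invmx (batch_Sigma f h x0 S Q Rn)) =
    ukf_gain f h x0 S Rn.
  rewrite -(information_gain Pxx_unit Sigma_unit Pzz_unit PzzE) -infoE Pxx_H.
  by rewrite mulKmx //; apply/posdef_unitmx/posdef_congr/posdef_inv.
have xhatE w : xhat w = xpred + ukf_gain f h x0 S Rn *m (z w - c).
  (* Centring the data at [Htilde *m xpred] makes the lower block zero, so only the observation
     block of the gain survives, applied to [z w - c]. *)
  have -> : xhat w =
      wls_estimate Htilde W (Htilde *m xpred + col_mx (z w - c) 0).
    congr wls_estimate; rewrite /ztilde /batch_z mul_col_mx mul1mx add_col_mx.
    by rewrite addr0 -addrA addrCA.
  rewrite wls_estimate_linear // /wls_estimate -(mulmxA _ _ (invmx W)) HW.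
  by rewrite -mulmxA mul_row_col mulmx0 addr0 mulmxA gainE.
split=> //; split=> //.
- by move=> w; exact: wls_estimate_min.
(* The error is the gain applied to [etilde], so its second moment is the congruence of [W] computed
   in [wls_gain_cov]. *)
- have -> : (fun w => xhat w - x w) =
      (fun w => wls_cov Htilde W *m Htilde^T *m invmx W *m etilde w).
    apply/funext => w.
    by rewrite /xhat modelE wls_estimate_linear // addrC addKr.
  rewrite -[X in has_second_moment _ _ X](wls_gain_cov Htilde_inj W_posdef).
  apply: second_moment_mul eW; apply: random_vector_col_mx.
    exact: random_vectorD.
  exact: random_vectorN (random_vectorD _ _).
- by move=> cE w; rewrite xhatE cE.
Qed.
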